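(* Let $\Lambda=\begin{pmatrix} A & A\otimes B \\ B\otimes A & B \end{pmatrix}$ be a square algebra where the corner bimodules $M=B\otimes A$ and $N=A\otimes B$ are free of rank one, and let $\mathbb A=A\times B$, $\mathbb M=M\oplus N$. The morphism $$\nabla'_{2m}:\mathsf{Hom}_{\mathbb A-\mathbb A}\left(\mathbb M^{\otimes_{\mathbb A}2m},\mathbb A\right)\to\mathsf{Hom}_{\mathbb A-\mathbb A}\left(\mathbb M^{\otimes_{\mathbb A}2m+1},\mathbb M\right)$$ is injective for $m>0$, except if $A=k$ and $B=k$.
   Context: $k$ is a field; algebras are nonzero associative unital $k$-algebras, not necessarily finite dimensional; $\otimes=\otimes_k$; $\mathsf{Hom}_{\mathbb A-\mathbb A}$ denotes morphisms of $\mathbb A$-bimodules. A square algebra is given by algebras $A$ and $B$, a $B$-$A$-bimodule $M$, an $A$-$B$-bimodule $N$ (the corner bimodules), and bimodule maps $\alpha:N\otimes_BM\to A$ and $\beta:M\otimes_AN\to B$ satisfying the associativity constraints $\beta(m\otimes n)m'=m\,\alpha(n\otimes m')$ and $\alpha(n\otimes m)n'=n\,\beta(m\otimes n')$. The square algebra is $\begin{pmatrix} A & N \\ M & B \end{pmatrix}$ with matrix multiplication, where $nm=\alpha(n\otimes m)$ and $mn=\beta(m\otimes n)$. If the corner bimodules are free of rank one and not both $A=k$ and $B=k$, then automatically $\alpha=\beta=0$, so that $\Lambda=\mathbb A\oplus\mathbb M$ with $\mathbb M^2=0$ ($\mathbb M$ is an $\mathbb A$-bimodule by extending actions by zero). **The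 map $\nabla'_{2m}$.** Assume $\alpha=\beta=0$ and $\mathbb M$ projective. Let $D=k\times k\subset\mathbb A$ and let $\mathsf J^\bullet$ be the complex $\mathsf J^0=\Lambda^D$, $\mathsf J^n=\mathsf{Hom}_{D-D}(\Lambda^{\otimes_Dn},\Lambda)$ with the Hochschild coboundary. Let $\mathsf D^\bullet\subset\mathsf J^\bullet$ be the subcomplex of cochains that vanish on all tensors $x_1\otimes\cdots\otimes x_n$ (each $x_i$ in $\mathbb A$ or $\mathbb M$) having an even number of factors in $\mathbb M$ (in degree $0$, $\mathsf D^0=0$). For $m>0$, $\mathsf H^{2m}((\mathsf J/\mathsf D)^\bullet)=\mathsf{HH}^{2m}(\mathbb A)\oplus\mathsf{Hom}_{\mathbb A-\mathbb A}(\mathbb M^{\otimes_{\mathbb A}2m},\mathbb A)$ and $\mathsf H^{2m+1}(\mathsf D^\bullet)=\mathsf{Hom}_{\mathbb A-\mathbb A}(\mathbb M^{\otimes_{\mathbb A}2m+1},\mathbb M)$, where $\mathsf{HH}$ is Hochschild cohomology. $\nabla'_{2m}$ is the restriction to the summand $\mathsf{Hom}_{\mathbb A-\mathbb A}(\mathbb M^{\otimes_{\mathbb A}2m},\mathbb A)$ of the connecting homomorphism of $0\to\mathsf D^\bullet\to\mathsf J^\bullet\to(\mathsf J/\mathsf D)^\bullet\to0$. Explicitly, $\nabla'_{2m}(\varphi)(x_1\otimes\cdots\otimes x_{2m+1})=x_1\varphi(x_2\otimes\cdots\otimes x_{2m+1})-\varphi(x_1\otimes\cdots\otimes x_{2m})x_{2m+1}$.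 *)

(* Defs.v *)
From HB Require Import structures.
From mathcomp Require Import all_boot all_order all_algebra.
From mathcomp Require Import generic_quotient ring_quotient.
From mathcomp Require Import finmap monalg.
From mathcomp Require Import boolp.

Set Implicit Arguments.
Unset Strict Implicit.
Unset Printing Implicit Defensive.

Import GRing.Theory.
Local Open Scope ring_scope.
Local Open Scope quotient_scope.

Section QuotientModule.
Variables (k : fieldType) (V : lmodType k) (S : V -> Prop).

(* Membership in the smallest subspace of V containing S. *)
Definition in_span (v : V) : Prop := forall P : V -> Prop,
  P 0 -> (forall c u w, P u -> P w -> P (c *: u + w)) ->
  (forall s, S s -> P s) -> P v.

Definition span_pred : {pred V} := fun v => `[< in_span v >].

Lemma in_spanP v : reflect (in_span v) (v \in span_pred).
Proof. exact: asboolP. Qed.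

Lemma in_span0 : in_span 0. Proof. by move=> P P0. Qed.

Lemma in_spanZD c u w : in_span u -> in_span w -> in_span (c *: u + w).
Proof. by move=> Su Sw P P0 PD PS; exact: (PD c u w (Su P P0 PD PS) (Sw P P0 PD PS)). Qed.

Lemma span_pred_closed : zmod_closed span_pred.
Proof.
split=> [|u v /in_spanP Su /in_spanP Sv]; apply/in_spanP; first exact: in_span0.
by rewrite addrC -scaleN1r; apply: in_spanZD.
Qed.

HB.instance Definition _ := GRing.isZmodClosed.Build V span_pred span_pred_closed.

Definition lquot : Type := {ideal_quot span_pred}.

HB.instance Definition _ := GRing.Zmodule.on lquot.

Definition lquot_pi (v : V) : lquot := \pi_({ideal_quot span_pred}) v.

Lemma lquot_pi_is_additive : zmod_morphism lquot_pi.
Proof. exact: raddfB. Qed.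
HB.instance Definition _ :=
  GRing.isZmodMorphism.Build V lquot lquot_pi lquot_pi_is_additive.

Lemma lquot_pi_eq u v : lquot_pi u = lquot_pi v <-> in_span (u - v).
Proof.
split=> [|/in_spanP].
  by move/eqP; rewrite -Quotient.idealrBE => /in_spanP.
by rewrite Quotient.idealrBE => /eqP.
Qed.

Lemma lquot_piS s : S s -> lquot_pi s = 0.
Proof.
move=> Ss; rewrite -(raddf0 lquot_pi); apply/lquot_pi_eq; rewrite subr0.
by move=> P _ _; apply.
Qed.

Definition lquot_rep (q : lquot) : V := repr (q : {ideal_quot span_pred}).

Lemma lquot_repK : cancel lquot_rep lquot_pi. Proof. exact: reprK. Qed.

Definition lquot_scale (c : k) (q : lquot) : lquot := lquot_pi (c *: lquot_rep q).

Lemma lquot_scaleE c v : lquot_scale c (lquot_pi v) = lquot_pi (c *: v).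
Proof.
apply/lquot_pi_eq; rewrite -scalerBr -[X in in_span X]addr0.
by apply: in_spanZD in_span0; apply/lquot_pi_eq; rewrite lquot_repK.
Qed.

Lemma lquot_scaleA a b v : lquot_scale a (lquot_scale b v) = lquot_scale (a * b) v.
Proof. by rewrite -[v]lquot_repK !lquot_scaleE scalerA. Qed.
Lemma lquot_scale1 : left_id 1 lquot_scale.
Proof. by move=> v; rewrite -[v]lquot_repK !lquot_scaleE scale1r. Qed.
Lemma lquot_scaleDr : right_distributive lquot_scale +%R.
Proof.
move=> a u v; rewrite -[u]lquot_repK -[v]lquot_repK.
by rewrite -raddfD !lquot_scaleE scalerDr raddfD.
Qed.
Lemma lquot_scaleDl v : {morph lquot_scale^~ v : a b / a + b}.
Proof.
by move=> a b; rewrite -[v]lquot_repK !lquot_scaleE scalerDl raddfD.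
Qed.
HB.instance Definition _ := GRing.Zmodule_isLmodule.Build k lquot
  lquot_scaleA lquot_scale1 lquot_scaleDr lquot_scaleDl.

Lemma lquot_pi_is_scalable : scalable lquot_pi.
Proof. by move=> c v; rewrite -lquot_scaleE. Qed.
HB.instance Definition _ :=
  GRing.isScalable.Build k V lquot *:%R lquot_pi lquot_pi_is_scalable.

Section Lift.
Variables (W : lmodType k) (f : {linear V -> W}) (fS : forall s, S s -> f s = 0).

Definition lquot_lift (q : lquot) : W := f (lquot_rep q).

Lemma lquot_liftE v : lquot_lift (lquot_pi v) = f v.
Proof.
have /lquot_pi_eq h: lquot_pi (lquot_rep (lquot_pi v)) = lquot_pi v.
  by rewrite lquot_repK.
apply/eqP; rewrite -subr_eq0 -raddfB; apply/eqP; apply: (h (fun x => f x = 0)) => //.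
- exact: raddf0.
- by move=> c u w u0 w0; rewrite linearP u0 w0 scaler0 addr0.
Qed.

Lemma lquot_lift_is_linear : linear lquot_lift.
Proof.
move=> c u v; rewrite -[u]lquot_repK -[v]lquot_repK -linearP !lquot_liftE.
exact: linearP.
Qed.
HB.instance Definition _ :=
  GRing.isLinear.Build k lquot W *:%R lquot_lift lquot_lift_is_linear.
End Lift.

End QuotientModule.

Section FreeModule.
Variables (k : fieldType) (K : choiceType) (W : lmodType k) (h : K -> W).

Definition free_lift (u : {malg k[K]}) : W := \sum_(x <- msupp u) u@_x *: h x.

Lemma free_liftEw (u : {malg k[K]}) (D : {fset K}) :
  fsubset (msupp u) D -> free_lift u = \sum_(x <- D) u@_x *: h x.
Proof.
move=> sub; rewrite /free_lift (big_fset_incl _ sub) //= => x _ xu.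
by rewrite mcoeff_outdom // scale0r.
Qed.

Lemma free_lift_is_linear : linear free_lift.
Proof.
move=> c u v; pose D := (msupp u `|` msupp v `|` msupp (c *: u + v))%fset.
have sub3 : fsubset (msupp (c *: u + v)) D by apply: fsubsetUr.
have sub1 : fsubset (msupp u) D by rewrite /D -fsetUA; apply: fsubsetUl.
have sub2 : fsubset (msupp v) D.
  by rewrite /D [(msupp u `|` _)%fset]fsetUC -fsetUA; apply: fsubsetUl.
rewrite (free_liftEw sub1) (free_liftEw sub2) (free_liftEw sub3).
rewrite scaler_sumr -big_split /=; apply: eq_bigr => x _.
by rewrite mcoeffD mcoeffZ scalerDl scalerA.
Qed.
HB.instance Definition _ :=
  GRing.isLinear.Build k {malg k[K]} W *:%R free_lift free_lift_is_linear.

Lemma free_liftU x : free_lift << x >> = h x.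
Proof.
by rewrite /free_lift msuppU oner_eq0 big_seq_fset1 mcoeffUU scale1r.
Qed.
End FreeModule.

HB.mixin Record isBimodule (k : fieldType) (A B : algType k) V
    of GRing.Lmodule k V := {
  lact : A -> V -> V;
  ract : V -> B -> V;
  lactDr : forall a, {morph lact a : x y / x + y};
  lactDl : forall x, {morph lact^~ x : a b / a + b};
  lactA : forall a b x, lact a (lact b x) = lact (a * b) x;
  lactZ : forall c x, lact (c%:A) x = c *: x;
  ractDl : forall b, {morph ract^~ b : x y / x + y};
  ractDr : forall x, {morph ract x : a b / a + b};
  ractA : forall x a b, ract (ract x a) b = ract x (a * b);
  ractZ : forall c x, ract x (c%:A) = c *: x;
  lract : forall a x b, ract (lact a x) b = lact a (ract x b) }.

#[short(type="bimodType")]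
HB.structure Definition Bimodule (k : fieldType) (A B : algType k) :=
  { V of GRing.Lmodule k V & isBimodule k A B V }.

Section BimoduleTheory.
Variables (k : fieldType) (A B : algType k) (X : bimodType A B).

Lemma lact1 (x : X) : lact 1 x = x.
Proof. by rewrite -[1 in LHS]scale1r lactZ scale1r. Qed.
Lemma ract1 (x : X) : ract x 1 = x.
Proof. by rewrite -[1 in LHS]scale1r ractZ scale1r. Qed.
Lemma lactS c a (x : X) : lact (c *: a) x = c *: lact a x.
Proof. by rewrite -[in LHS](mul1r a) scalerAl -lactA lactZ. Qed.
Lemma ractS c b (x : X) : ract x (c *: b) = c *: ract x b.
Proof. by rewrite -[in LHS](mulr1 b) scalerAr -ractA ractZ. Qed.
Lemma lactSr c a (x : X) : lact a (c *: x) = c *: lact a x.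
Proof. by rewrite -lactZ lactA -scalerAr mulr1 lactS. Qed.
Lemma ractSl c b (x : X) : ract (c *: x) b = c *: ract x b.
Proof. by rewrite -ractZ ractA -scalerAl mul1r ractS. Qed.
Lemma lact0 a : lact a (0 : X) = 0.
Proof. by rewrite -[in LHS](scale0r (0 : X)) lactSr !scale0r. Qed.
Lemma lact0l (x : X) : lact 0 x = 0.
Proof. by rewrite -[in LHS](scale0r (1 : A)) lactZ !scale0r. Qed.
Lemma ract0 (x : X) : ract x 0 = 0.
Proof. by rewrite -[in LHS](scale0r (1 : B)) ractZ !scale0r. Qed.
Lemma ract0l b : ract (0 : X) b = 0.
Proof. by rewrite -[in LHS](scale0r (0 : X)) ractSl !scale0r. Qed.
End BimoduleTheory.

Record bimodHom (k : fieldType) (A B : algType k) (X Y : bimodType A B) :=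
  BimodHom {
    bimodHom_fun :> X -> Y;
    bimodHom_linear : linear bimodHom_fun;
    bimodHom_lact : forall a x, bimodHom_fun (lact a x) = lact a (bimodHom_fun x);
    bimodHom_ract : forall x b, bimodHom_fun (ract x b) = ract (bimodHom_fun x) b }.

HB.instance Definition _ (k : fieldType) (A B : algType k) (X Y : bimodType A B)
    (f : bimodHom X Y) :=
  GRing.isLinear.Build k X Y *:%R f (bimodHom_linear f).

Lemma bimodHomP (k : fieldType) (A B : algType k) (X Y : bimodType A B)
  (f g : bimodHom X Y) : f =1 g -> f = g.
Proof.
case: f g => [f fL fl fr] [g gL gl gr] /= /funext fg; subst g.
by congr BimodHom; apply: Prop_irrelevance.
Qed.

Section Comp.
Variables (k : fieldType) (A B : algType k) (X Y Z : bimodType A B).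
Variables (g : bimodHom Y Z) (f : bimodHom X Y).
Let h (x : X) : Z := g (f x).
Fact comp_linear : linear h. Proof. by move=> c u v; rewrite /h !linearP. Qed.
Fact comp_lact a x : h (lact a x) = lact a (h x).
Proof. by rewrite /h !bimodHom_lact. Qed.
Fact comp_ract x b : h (ract x b) = ract (h x) b.
Proof. by rewrite /h !bimodHom_ract. Qed.
Definition bimod_comp : bimodHom X Z := BimodHom comp_linear comp_lact comp_ract.
End Comp.

Section Tensor.
Variables (k : fieldType) (A R C : algType k).
Variables (X : bimodType A R) (Y : bimodType R C).

(* X tensor Y over R is the free k-module on X * Y modulo the span of these
   relations; C acts on the right through Y, A on the left through X. *)
Inductive tensor_rel : {malg k[(X * Y)%type]} -> Prop :=
| TensorDl x x' y : tensor_rel (<< (x + x', y) >> - << (x, y) >> - << (x', y) >>)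
| TensorDr x y y' : tensor_rel (<< (x, y + y') >> - << (x, y) >> - << (x, y') >>)
| TensorZ c x y : tensor_rel (<< (c *: x, y) >> - c *: << (x, y) >>)
| TensorB x r y : tensor_rel (<< (ract x r, y) >> - << (x, lact r y) >>).

Definition tensor : Type := lquot tensor_rel.
HB.instance Definition _ := GRing.Lmodule.on tensor.

Definition tens (x : X) (y : Y) : tensor := lquot_pi tensor_rel << (x, y) >>.

Lemma tensDl x x' y : tens (x + x') y = tens x y + tens x' y.
Proof.
apply/eqP; rewrite -subr_eq0 opprD addrA -!raddfB; apply/eqP.
exact/lquot_piS/TensorDl.
Qed.
Lemma tensDr x y y' : tens x (y + y') = tens x y + tens x y'.
Proof.
apply/eqP; rewrite -subr_eq0 opprD addrA -!raddfB; apply/eqP.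
exact/lquot_piS/TensorDr.
Qed.
Lemma tensZl c x y : tens (c *: x) y = c *: tens x y.
Proof.
apply/eqP; rewrite -subr_eq0 -linearZ -raddfB; apply/eqP.
exact/lquot_piS/TensorZ.
Qed.
Lemma tensB x r y : tens (ract x r) y = tens x (lact r y).
Proof.
apply/eqP; rewrite -subr_eq0 -raddfB; apply/eqP.
exact/lquot_piS/TensorB.
Qed.
Lemma tensZr c x y : tens x (c *: y) = c *: tens x y.
Proof. by rewrite -lactZ -tensB ractZ tensZl. Qed.

Definition balanced (W : lmodType k) (f : X -> Y -> W) : Prop :=
  [/\ forall x x' y, f (x + x') y = f x y + f x' y,
      forall x y y', f x (y + y') = f x y + f x y',
      forall c x y, f (c *: x) y = c *: f x y &
      forall x r y, f (ract x r) y = f x (lact r y)].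

Section Lift.
Variables (W : lmodType k) (f : X -> Y -> W) (fP : balanced f).

Fact tensor_lift_rel s : tensor_rel s -> free_lift (fun p => f p.1 p.2) s = 0.
Proof.
case: fP => fDl fDr fZ fB [x x' y|x y y'|c x y|x r y];
  rewrite !raddfB /= ?linearZ /= !free_liftU /=.
- by rewrite fDl -addrA -opprD subrr.
- by rewrite fDr -addrA -opprD subrr.
- by rewrite fZ scalerN subrr.
- by rewrite fB subrr.
Qed.

Definition tensor_lift : tensor -> W :=
  lquot_lift (free_lift (fun p => f p.1 p.2)).

Lemma tensor_lift_is_linear : linear tensor_lift.
Proof. exact: (lquot_lift_is_linear tensor_lift_rel). Qed.

Lemma tensor_liftE x y : tensor_lift (tens x y) = f x y.
Proof. by rewrite /tensor_lift (lquot_liftE tensor_lift_rel) /= free_liftU. Qed.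
End Lift.

Lemma tensor_ext_linear (W : lmodType k) (f g : {linear tensor -> W}) :
  (forall x y, f (tens x y) = g (tens x y)) -> f =1 g.
Proof.
move=> fg q; rewrite -[q]lquot_repK; move: (lquot_rep q) => u.
rewrite [u]monalgE !raddf_sum /=; apply: eq_bigr => -[x y] _.
have -> : << u@_(x, y) *g (x, y) >> = u@_(x, y) *: << (x, y) >>.
  by apply/malgP => z; rewrite mcoeffZ !mcoeffU mulr_natr.
by rewrite !linearZ /=; congr (_ *: _); apply: fg.
Qed.

Lemma tensor_ext (W : lmodType k) (f g : tensor -> W) :
  linear f -> linear g -> (forall x y, f (tens x y) = g (tens x y)) -> f =1 g.
Proof.
move=> fL gL.
pose f' : {linear _ -> _} := HB.pack f (GRing.isLinear.Build _ _ _ _ f fL).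
pose g' : {linear _ -> _} := HB.pack g (GRing.isLinear.Build _ _ _ _ g gL).
exact: (@tensor_ext_linear W f' g').
Qed.

End Tensor.
Opaque tens tensor_lift.

Section TensorBimodule.
Variables (k : fieldType) (A R C : algType k).
Variables (X : bimodType A R) (Y : bimodType R C).

Local Notation XY := (tensor X Y).

Definition tensor_lact (a : A) : XY -> XY :=
  tensor_lift (fun x y => tens (lact a x) y).
Definition tensor_ract (u : XY) (c : C) : XY :=
  tensor_lift (fun x y => tens x (ract y c)) u.

Fact tensor_lact_balanced a : balanced (fun x y => tens (lact a x) y : XY).
Proof.
split=> [x x' y|x y y'|c x y|x r y].
- by rewrite lactDr tensDl.
- by rewrite tensDr.
- by rewrite lactSr tensZl.
- by rewrite -lract tensB.
Qed.

Fact tensor_ract_balanced c : balanced (fun x y => tens x (ract y c) : XY).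
Proof.
split=> [x x' y|x y y'|d x y|x r y].
- by rewrite tensDl.
- by rewrite ractDl tensDr.
- by rewrite tensZl.
- by rewrite tensB lract.
Qed.

Lemma tensor_lactE a (x : X) (y : Y) : tensor_lact a (tens x y) = tens (lact a x) y.
Proof. exact: (tensor_liftE (tensor_lact_balanced a)). Qed.
Lemma tensor_ractE (x : X) (y : Y) c : tensor_ract (tens x y) c = tens x (ract y c).
Proof. exact: (tensor_liftE (tensor_ract_balanced c)). Qed.

Fact tensor_lact_linear a : linear (tensor_lact a).
Proof. exact: (tensor_lift_is_linear (tensor_lact_balanced a)). Qed.
Fact tensor_ract_linear c : linear (tensor_ract^~ c).
Proof. exact: (tensor_lift_is_linear (tensor_ract_balanced c)). Qed.

Fact tensor_lactDr a : {morph tensor_lact a : u v / u + v}.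
Proof.
by move=> u v; rewrite -[u in LHS]scale1r tensor_lact_linear scale1r.
Qed.
Fact tensor_ractDl c : {morph tensor_ract^~ c : u v / u + v}.
Proof.
by move=> u v; rewrite -[u in LHS]scale1r tensor_ract_linear scale1r.
Qed.
Fact tensor_lactDl u : {morph tensor_lact^~ u : a b / a + b}.
Proof.
move=> a b; move: u; apply: tensor_ext.
- exact: tensor_lact_linear.
- by move=> c u v; rewrite !tensor_lact_linear scalerDr addrACA.
- by move=> x y; rewrite !tensor_lactE lactDl tensDl.
Qed.
Fact tensor_ractDr u : {morph tensor_ract u : a b / a + b}.
Proof.
move=> a b; move: u; apply: tensor_ext.
- exact: tensor_ract_linear.
- by move=> c u v; rewrite !tensor_ract_linear scalerDr addrACA.
- by move=> x y; rewrite !tensor_ractE ractDr tensDr.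
Qed.
Fact tensor_lactA a b u : tensor_lact a (tensor_lact b u) = tensor_lact (a * b) u.
Proof.
move: u; apply: tensor_ext.
- by move=> c u v; rewrite !tensor_lact_linear.
- exact: tensor_lact_linear.
- by move=> x y; rewrite !tensor_lactE lactA.
Qed.
Fact tensor_ractA u a b : tensor_ract (tensor_ract u a) b = tensor_ract u (a * b).
Proof.
move: u; apply: tensor_ext.
- by move=> c u v; rewrite !tensor_ract_linear.
- exact: tensor_ract_linear.
- by move=> x y; rewrite !tensor_ractE ractA.
Qed.
Fact scale_linear (V : lmodType k) (c : k) : linear (fun v : V => c *: v).
Proof. by move=> d u v; rewrite scalerDr !scalerA mulrC. Qed.
Fact tensor_lactZ c u : tensor_lact c%:A u = c *: u.
Proof.
move: u; apply: tensor_ext; [exact: tensor_lact_linear|exact: scale_linear|].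
by move=> x y; rewrite tensor_lactE lactZ tensZl.
Qed.
Fact tensor_ractZ c u : tensor_ract u c%:A = c *: u.
Proof.
move: u; apply: tensor_ext; [exact: tensor_ract_linear|exact: scale_linear|].
by move=> x y; rewrite tensor_ractE ractZ tensZr.
Qed.
Fact tensor_lract a u c :
  tensor_ract (tensor_lact a u) c = tensor_lact a (tensor_ract u c).
Proof.
move: u; apply: tensor_ext.
- by move=> d u v; rewrite !tensor_lact_linear !tensor_ract_linear.
- by move=> d u v; rewrite !tensor_ract_linear !tensor_lact_linear.
- by move=> x y; rewrite tensor_lactE !tensor_ractE tensor_lactE.
Qed.

HB.instance Definition _ := isBimodule.Build k A C XY
  tensor_lactDr tensor_lactDl tensor_lactA tensor_lactZ
  tensor_ractDl tensor_ractDr tensor_ractA tensor_ractZ tensor_lract.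

Lemma lact_tens a (x : X) (y : Y) : lact a (tens x y) = tens (lact a x) y.
Proof. exact: tensor_lactE. Qed.
Lemma ract_tens (x : X) (y : Y) c : ract (tens x y) c = tens x (ract y c).
Proof. exact: tensor_ractE. Qed.

Section Lift.
Variables (Z : bimodType A C) (f : X -> Y -> Z) (fP : balanced f).
Hypothesis f_lact : forall a x y, f (lact a x) y = lact a (f x y).
Hypothesis f_ract : forall x y c, f x (ract y c) = ract (f x y) c.

Fact tensor_hom_lact a u : tensor_lift f (lact a u) = lact a (tensor_lift f u).
Proof.
move: u; apply: tensor_ext.
- by move=> c u v; rewrite lactDr lactSr (tensor_lift_is_linear fP).
- by move=> c u v; rewrite (tensor_lift_is_linear fP) lactDr lactSr.
- by move=> x y; rewrite lact_tens !(tensor_liftE fP).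
Qed.
Fact tensor_hom_ract u c : tensor_lift f (ract u c) = ract (tensor_lift f u) c.
Proof.
move: u; apply: tensor_ext.
- by move=> d u v; rewrite ractDl ractSl (tensor_lift_is_linear fP).
- by move=> d u v; rewrite (tensor_lift_is_linear fP) ractDl ractSl.
- by move=> x y; rewrite ract_tens !(tensor_liftE fP).
Qed.
Definition tensor_hom : bimodHom XY Z :=
  BimodHom (tensor_lift_is_linear fP) tensor_hom_lact tensor_hom_ract.
Lemma tensor_homE x y : tensor_hom (tens x y) = f x y.
Proof. exact: tensor_liftE. Qed.
End Lift.
End TensorBimodule.

Opaque tensor_lact tensor_ract.

Section Regular.
Variables (k : fieldType) (A : algType k).

(* A as an A-A-bimodule, an A-k-bimodule and a k-A-bimodule. *)
Definition regular : Type := A.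
Definition lregular : Type := A.
Definition rregular : Type := A.

HB.instance Definition _ := GRing.Lmodule.on regular.
HB.instance Definition _ := GRing.Lmodule.on lregular.
HB.instance Definition _ := GRing.Lmodule.on rregular.

Fact mulZl (c : k) (x : A) : c%:A * x = c *: x.
Proof. by rewrite -scalerAl mul1r. Qed.
Fact mulZr (c : k) (x : A) : x * c%:A = c *: x.
Proof. by rewrite -scalerAr mulr1. Qed.
Fact mulDr_morph (a : A) : {morph *%R a : x y / x + y}.
Proof. exact: mulrDr. Qed.
Fact mulDl_morph (a : A) : {morph *%R^~ a : x y / x + y}.
Proof. by move=> x y; rewrite mulrDl. Qed.
Fact mul_assocl (a b x : A) : a * (b * x) = a * b * x.
Proof. exact: mulrA. Qed.
Fact mul_assocr (x a b : A) : x * a * b = x * (a * b).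
Proof. by rewrite mulrA. Qed.

HB.instance Definition _ := @isBimodule.Build k A A regular
  *%R *%R mulDr_morph mulDl_morph mul_assocl mulZl
  mulDl_morph mulDr_morph mul_assocr mulZr mul_assocr.

Fact scaleDl_morph (x : A) : {morph (fun c : k^o => c *: x) : a b / a + b}.
Proof. by move=> a b; rewrite scalerDl. Qed.
Fact scaleDr_morph (c : k^o) : {morph (fun x : A => (c : k) *: x) : x y / x + y}.
Proof. by move=> x y; rewrite scalerDr. Qed.
Fact scale_assocl (a b : k^o) (x : A) : (a : k) *: ((b : k) *: x) = (a * b) *: x.
Proof. exact: scalerA. Qed.
Fact scale_assocr (x : A) (a b : k^o) :
  (b : k) *: ((a : k) *: x) = (a * b) *: x.
Proof. by rewrite scalerA mulrC. Qed.
Fact scale_unit (c : k) (x : A) : (c%:A : k^o) *: x = c *: x.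
Proof. by congr (_ *: x); apply: mulr1. Qed.
Fact scale_mull (a x : A) (c : k^o) : (c : k) *: (a * x) = a * ((c : k) *: x).
Proof. by rewrite scalerAr. Qed.
Fact scale_mulr (c : k^o) (x b : A) : ((c : k) *: x) * b = (c : k) *: (x * b).
Proof. by rewrite scalerAl. Qed.

HB.instance Definition _ := @isBimodule.Build k A k^o lregular
  *%R (fun x c => (c : k) *: x) mulDr_morph mulDl_morph mul_assocl mulZl
  scaleDr_morph scaleDl_morph scale_assocr scale_unit scale_mull.

HB.instance Definition _ := @isBimodule.Build k k^o A rregular
  (fun c x => (c : k) *: x) *%R scaleDr_morph scaleDl_morph scale_assocl scale_unit
  mulDl_morph mulDr_morph mul_assocr mulZr scale_mulr.
End Regular.

(* A tensor B over k, with a . (x tensor y) . b = ax tensor yb. *)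
Definition free_bimod (k : fieldType) (A B : algType k) : bimodType A B :=
  tensor (lregular A) (rregular B).
Section TensorPower.
Variables (k : fieldType) (R : algType k) (V : bimodType R R).

(* The n-th tensor power of V over R: R if n = 0, and V tensor V^(n-1) if not. *)
Fixpoint tpow (n : nat) : bimodType R R :=
  if n is n'.+1 then tensor V (tpow n') else regular R.

(* pure n x is x_1 tensor ... tensor x_n, with x_(i+1) written x i. *)
Fixpoint pure (n : nat) : ('I_n -> V) -> tpow n :=
  if n is n'.+1 return ('I_n -> V) -> tpow n
  then fun x => tens (x ord0) (pure (fun i => x (lift ord0 i)))
  else fun _ => (1 : R).

Let swap0_fun (v : V) (r : regular R) : tensor (tpow 0) V :=
  tens (1 : regular R) (ract v r).

Fact swap0_balanced : balanced swap0_fun.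
Proof.
rewrite /swap0_fun; split=> [x x' y|x y y'|c x y|x r y].
- by rewrite ractDl tensDr.
- by rewrite ractDr tensDr.
- by rewrite ractSl tensZr.
- by rewrite ractA.
Qed.
Fact swap0_lact a v r : swap0_fun (lact a v) r = lact a (swap0_fun v r).
Proof.
rewrite /swap0_fun lact_tens lract -tensB; congr (tens _ _).
by rewrite /lact /ract /= mul1r mulr1.
Qed.
Fact swap0_ract v r c : swap0_fun v (ract r c) = ract (swap0_fun v r) c.
Proof. by rewrite /swap0_fun ract_tens ractA. Qed.

Section Step.
Variables (n : nat) (sw : bimodHom (tensor V (tpow n)) (tensor (tpow n) V)).

Let assoc_in (v : V) : tensor (tpow n) V -> tensor (tpow n.+1) V :=
  tensor_lift (fun t w => tens (tens v t : tpow n.+1) w).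

Fact assoc_in_balanced v :
  balanced (fun t w => tens (tens v t : tpow n.+1) w : tensor (tpow n.+1) V).
Proof.
split=> [x x' y|x y y'|c x y|x r y].
- by rewrite tensDr tensDl.
- by rewrite tensDr.
- by rewrite tensZr tensZl.
- by rewrite -tensB ract_tens.
Qed.
Fact assoc_inE v t w : assoc_in v (tens t w) = tens (tens v t : tpow n.+1) w.
Proof. exact: (tensor_liftE (assoc_in_balanced v)). Qed.
Fact assoc_in_linear v : linear (assoc_in v).
Proof. exact: (tensor_lift_is_linear (assoc_in_balanced v)). Qed.
Fact assoc_inD v : {morph assoc_in v : x y / x + y}.
Proof. by move=> x y; rewrite -[x in LHS]scale1r assoc_in_linear scale1r. Qed.
Fact assoc_inDl v v' u : assoc_in (v + v') u = assoc_in v u + assoc_in v' u.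
Proof.
move: u; apply: tensor_ext; first exact: assoc_in_linear.
  by move=> c u w; rewrite !assoc_in_linear scalerDr addrACA.
by move=> t w; rewrite !assoc_inE !tensDl.
Qed.
Fact assoc_inZl c v u : assoc_in (c *: v) u = c *: assoc_in v u.
Proof.
move: u; apply: tensor_ext; first exact: assoc_in_linear.
  by move=> d u w; rewrite !assoc_in_linear scalerDr !scalerA mulrC.
by move=> t w; rewrite !assoc_inE !tensZl.
Qed.
Fact assoc_inB v r u : assoc_in (ract v r) u = assoc_in v (lact r u).
Proof.
move: u; apply: tensor_ext; first exact: assoc_in_linear.
  by move=> d u w; rewrite lactDr lactSr !assoc_in_linear.
by move=> t w; rewrite lact_tens !assoc_inE tensB.
Qed.
Fact assoc_in_lact a v u : assoc_in (lact a v) u = lact a (assoc_in v u).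
Proof.
move: u; apply: tensor_ext; first exact: assoc_in_linear.
  by move=> d u w; rewrite assoc_in_linear lactDr lactSr.
by move=> t w; rewrite !assoc_inE !lact_tens.
Qed.
Fact assoc_in_ract v u c : assoc_in v (ract u c) = ract (assoc_in v u) c.
Proof.
move: u; apply: tensor_ext.
- by move=> d u w; rewrite ractDl ractSl assoc_in_linear.
- by move=> d u w; rewrite assoc_in_linear ractDl ractSl.
- by move=> t w; rewrite ract_tens !assoc_inE ract_tens.
Qed.

Let swapS_fun (v : V) (u : tensor V (tpow n)) := assoc_in v (sw u).

Fact swapS_balanced : balanced swapS_fun.
Proof.
rewrite /swapS_fun; split=> [x x' y|x y y'|c x y|x r y].
- exact: assoc_inDl.
- by rewrite raddfD assoc_inD.
- exact: assoc_inZl.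
- by rewrite bimodHom_lact assoc_inB.
Qed.
Fact swapS_lact a v r : swapS_fun (lact a v) r = lact a (swapS_fun v r).
Proof. exact: assoc_in_lact. Qed.
Fact swapS_ract v r c : swapS_fun v (ract r c) = ract (swapS_fun v r) c.
Proof. by rewrite /swapS_fun bimodHom_ract assoc_in_ract. Qed.

Definition swapS : bimodHom (tensor V (tpow n.+1)) (tensor (tpow n.+1) V) :=
  tensor_hom swapS_balanced swapS_lact swapS_ract.

Lemma swapSE v u t w :
  sw u = tens t w -> swapS (tens v u) = tens (tens v t : tpow n.+1) w.
Proof. by move=> swu; rewrite tensor_homE /swapS_fun swu assoc_inE. Qed.
End Step.

(* The associativity map V tensor V^n -> V^n tensor V, characterised by swap_pure. *)
Fixpoint swap (n : nat) : bimodHom (tpow n.+1) (tensor (tpow n) V) :=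
  if n is n'.+1 then swapS (swap n')
  else tensor_hom swap0_balanced swap0_lact swap0_ract.

Lemma swap_pure n (x : 'I_n.+1 -> V) :
  swap n (pure x) = tens (pure (fun i => x (lift ord_max i))) (x ord_max).
Proof.
elim: n x => [|n IHn] x.
  rewrite [swap 0]/= tensor_homE /swap0_fun /= ract1.
  by congr (tens _ (x _)); apply: val_inj.
have E : (fun i => x (lift ord0 (lift ord_max i))) =
         (fun i : 'I_n => x (lift ord_max (lift ord0 i))).
  apply: funext => i; congr x.
  by apply: val_inj; rewrite /= /bump !add1n ltnS; case: (n <= i)%N.
have E0 : lift ord_max ord0 = ord0 :> 'I_n.+2 by apply: val_inj.
have E1 : lift ord0 ord_max = ord_max :> 'I_n.+2 by apply: val_inj.
rewrite [swap n.+1]/=; apply: etrans (swapSE _ (IHn _)) _.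
by rewrite E E1 /= E0.
Qed.

Section Delta.
Variables (n : nat) (phi : bimodHom (tpow n) (regular R)).

Let dl_fun (v : V) (t : tpow n) : V := ract v (phi t).

Fact dl_balanced : balanced dl_fun.
Proof.
rewrite /dl_fun; split=> [x x' y|x y y'|c x y|x r y].
- by rewrite ractDl.
- by rewrite raddfD ractDr.
- by rewrite ractSl.
- by rewrite bimodHom_lact ractA.
Qed.
Fact dl_lact a v t : dl_fun (lact a v) t = lact a (dl_fun v t).
Proof. exact: lract. Qed.
Fact dl_ract v t c : dl_fun v (ract t c) = ract (dl_fun v t) c.
Proof. by rewrite /dl_fun bimodHom_ract ractA. Qed.

Let dr_fun (t : tpow n) (v : V) : V := lact (phi t) v.

Fact dr_balanced : balanced dr_fun.
Proof.
rewrite /dr_fun; split=> [x x' y|x y y'|c x y|x r y].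
- by rewrite raddfD lactDl.
- by rewrite lactDr.
- by rewrite linearZ lactS.
- by rewrite bimodHom_ract lactA.
Qed.
Fact dr_lact a v t : dr_fun (lact a v) t = lact a (dr_fun v t).
Proof. by rewrite /dr_fun bimodHom_lact lactA. Qed.
Fact dr_ract v t c : dr_fun v (ract t c) = ract (dr_fun v t) c.
Proof. by rewrite /dr_fun lract. Qed.

Definition delta_left : bimodHom (tpow n.+1) V :=
  tensor_hom dl_balanced dl_lact dl_ract.
Definition delta_right : bimodHom (tpow n.+1) V :=
  bimod_comp (tensor_hom dr_balanced dr_lact dr_ract) (swap n).

Lemma delta_leftE v t : delta_left (tens v t : tpow n.+1) = ract v (phi t).
Proof. exact: tensor_homE. Qed.

Lemma delta_rightE (x : 'I_n.+1 -> V) :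
  delta_right (pure x) =
  lact (phi (pure (fun i => x (lift ord_max i)))) (x ord_max).
Proof.
by apply: etrans (congr1 _ (swap_pure x)) _; apply: tensor_homE.
Qed.

Let d_fun (u : tpow n.+1) : V := delta_left u - delta_right u.
Fact d_linear : linear d_fun.
Proof.
move=> c u v; rewrite /d_fun (linearP delta_left) (linearP delta_right).
by rewrite scalerBr opprD addrACA.
Qed.
Fact d_lact a u : d_fun (lact a u) = lact a (d_fun u).
Proof.
by rewrite /d_fun !bimodHom_lact lactDr -[- delta_right u]scaleN1r lactSr scaleN1r.
Qed.
Fact d_ract u a : d_fun (ract u a) = ract (d_fun u) a.
Proof.
by rewrite /d_fun !bimodHom_ract ractDl -[- delta_right u]scaleN1r ractSl scaleN1r.
Qed.

Definition delta : bimodHom (tpow n.+1) V := BimodHom d_linear d_lact d_ract.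

Lemma deltaE (x : 'I_n.+1 -> V) :
  delta (pure x) =
    ract (x ord0) (phi (pure (fun i => x (lift ord0 i)))) -
    lact (phi (pure (fun i => x (lift ord_max i)))) (x ord_max).
Proof. by rewrite -delta_rightE -delta_leftE. Qed.
End Delta.
End TensorPower.

Section SquareAlgebra.
Variables (k : fieldType) (A B : algType k).
Variables (M : bimodType B A) (N : bimodType A B).

Record squareAlgebra := SquareAlgebra {
  alpha : bimodHom (tensor N M) (regular A);
  beta : bimodHom (tensor M N) (regular B);
  beta_alpha : forall m n m', lact (beta (tens m n)) m' = ract m (alpha (tens n m'));
  alpha_beta : forall n m n', lact (alpha (tens n m)) n' = ract n (beta (tens m n')) }.

(* The (A x B)-bimodule M + N; its actions are the products of diagonal and
   off-diagonal elements of the matrix algebra (A, N; M, B). *)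
Definition corners : Type := (M * N)%type.
HB.instance Definition _ := GRing.Lmodule.on corners.

Let cl (r : (A * B)%type) (x : corners) : corners := (lact r.2 x.1, lact r.1 x.2).
Let cr (x : corners) (r : (A * B)%type) : corners := (ract x.1 r.1, ract x.2 r.2).

Fact cornersDr r : {morph cl r : x y / x + y}.
Proof. by move=> x y; rewrite /cl !lactDr. Qed.
Fact cornersDl x : {morph cl^~ x : a b / a + b}.
Proof. by move=> a b; rewrite /cl !lactDl. Qed.
Fact cornersA a b x : cl a (cl b x) = cl (a * b) x.
Proof. by rewrite /cl /= !lactA. Qed.
Fact cornersZ c x : cl c%:A x = c *: x.
Proof. by rewrite /cl /= !lactZ. Qed.
Fact cornersDl' r : {morph cr^~ r : x y / x + y}.
Proof. by move=> x y; rewrite /cr !ractDl. Qed.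
Fact cornersDr' x : {morph cr x : a b / a + b}.
Proof. by move=> a b; rewrite /cr !ractDr. Qed.
Fact cornersA' x a b : cr (cr x a) b = cr x (a * b).
Proof. by rewrite /cr /= !ractA. Qed.
Fact cornersZ' c x : cr x c%:A = c *: x.
Proof. by rewrite /cr /= !ractZ. Qed.
Fact corners_lract a x b : cr (cl a x) b = cl a (cr x b).
Proof. by rewrite /cl /cr /= !lract. Qed.

HB.instance Definition _ :=
  @isBimodule.Build k (A * B)%type (A * B)%type corners cl cr
    cornersDr cornersDl cornersA cornersZ
    cornersDl' cornersDr' cornersA' cornersZ' corners_lract.
End SquareAlgebra.

Section Nabla.
Variables (k : fieldType) (A B : algType k).
Variables (M : bimodType B A) (N : bimodType A B).

(* The map nabla'_(2m); see deltaE for its values on pure tensors. It only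
   involves the bimodule structure of M and N, not the products alpha, beta. *)
Definition nabla (L : squareAlgebra M N) (m : nat) :
    bimodHom (tpow (corners M N) (2 * m)) (regular (A * B)%type) ->
    bimodHom (tpow (corners M N) (2 * m).+1) (corners M N) :=
  fun phi => delta phi.
End Nabla.

Arguments nabla {k A B M N} L m phi.

(* A = k, i.e. the structure map k -> A is an isomorphism. *)
Definition is_ground_field (k : fieldType) (A : algType k) : Prop :=
  bijective (fun c : k => c%:A : A).

(* Main.v *)
From HB Require Import structures.
Require Import Defs.
From mathcomp Require Import all_boot all_order all_algebra.
From mathcomp Require Import boolp classical_sets.

(** Write V for the bimodule of corners and R = A x B. A form phi on the n-th
tensor power of V, with n > 0, is killed by delta when
x_1 phi(x_2 ... x_{n+1}) = phi(x_1 ... x_n) x_{n+1}. Split x_1 ... x_{n+1} as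
u, y, v with u and v single vectors, and read this identity in the corner
M = B (x) A. There R acts on the right through A and on the left through B, so
only two components of phi survive: with f(u, y) the B-component of
phi(u ... y) and g(y, v) the A-component of phi(y ... v),

  u g(y, v) = f(u, y) v     for all u, v in M.

Take u = 1 (x) a and v = b (x) 1. Then 1 (x) a g(y, v) = f(u, y) b (x) 1 in the
tensor product B (x) A over the field k, which forces both a g(y, v) and
f(u, y) b to be scalars. The essential point is that v, and hence g(y, v), is
fixed while a varies, because n > 0 makes u and v two different entries. If A is
not k, an element all of whose multiples are scalars vanishes, so
g(y, 1 (x) 1) = 0 for all y; then f(u, y) (1 (x) 1) = u g(y, 1 (x) 1) = 0, so
f = 0, and then u g = 0 for u = 1 (x) 1, so g = 0. If B is not k, the same
argument starts from f(1 (x) 1, y) = 0. This is [corners_cancel]; as every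
family of n vectors has both shapes u, y and y, v, it kills both components of
phi, which is [delta_injective].

If A = B = k, both corners are lines, V is the off-diagonal part of the algebra
of 2 x 2 matrices over k, and the product of an even number of off-diagonal
matrices is a diagonal one. This product is a form on an even tensor power of V
that delta kills, by associativity. It is not zero, since the matrix with zero
diagonal and all other entries 1 squares to the identity
([delta_not_injective]).

The facts about tensor products over k rest on the existence of enough linear
functionals on an arbitrary vector space ([exists_functional]). *)

Set Implicit Arguments.
Unset Strict Implicit.
Unset Printing Implicit Defensive.

Import GRing.Theory.
Local Open Scope ring_scope.

(** * Linear functionals on vector spaces *)

Section LinearFunctionals.
Variables (k : fieldType).

(** A subspace U maximal among those avoiding v is a complement of the line of v,
and the functional is the coordinate along that line. *)
Lemma exists_functional (V : lmodType k) (v : V) :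
  v != 0 -> exists l : {linear V -> k^o}, l v = 1.
Proof.
move=> v0.
pose P (U : set V) := (forall c x y, U x -> U y -> U (c *: x + y)) /\ ~ U v.
(* [P] does not ask for 0, so that the union of the empty chain satisfies it;
   maximality gives 0 afterwards. *)
have [F FP Ftot|U [[UL Uv] Umax]] := @Zorn_bigcup V P.
  split=> [c x y [X FX Xx] [Y FY Yy]|[X FX Xv]]; last by case: (FP X FX) => _; apply.
  have [XY|YX] := Ftot _ _ FX FY.
    by exists Y => //; apply: (FP Y FY).1 => //; apply: XY.
  by exists X => //; apply: (FP X FX).1 => //; apply: YX.
have U0 : U 0.
  apply: contrapT => nU0; apply: (Umax (fun x => x = 0)).
    split=> [x Ux|]; last by move=> /(_ 0 erefl).
    by case: nU0; rewrite -(addNr x) -scaleN1r; apply: UL.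
  split=> [c x y -> ->|/eqP]; first by rewrite scaler0 addr0.
  by rewrite (negPf v0).
have UZ c x : U x -> U (c *: x) by move=> Ux; rewrite -[_ *: _]addr0; apply: UL.
have UB x y : U x -> U y -> U (x - y).
  by move=> Ux Uy; rewrite addrC -scaleN1r; apply: UL.
have coord w : exists c : k, U (w - c *: v).
  have [Uw|nUw] := pselect (U w); first by exists 0; rewrite scale0r subr0.
  (* B is the sum of U and the line of w: by maximality it contains v. *)
  pose B x := exists c : k, U (x - c *: w).
  have UB' : (U `<` B)%classic.
    split=> [x Ux|/(_ w) BU]; first by exists 0; rewrite scale0r subr0.
    by apply: nUw; apply: BU; exists 1; rewrite scale1r subrr.
  have [c Uc] : B v.
    apply: contrapT => nBv; apply: Umax UB' _; split=> // c x y [a Ua] [b Ub].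
    exists (c * a + b).
    rewrite scalerDl -scalerA opprD addrACA -scalerBr.
    exact: UL.
  have c0 : c != 0 by apply/negP => /eqP c0; move: Uc; rewrite c0 scale0r subr0.
  exists c^-1; move: (UZ (- c^-1) _ Uc).
  by rewrite scalerBr !scaleNr scalerA mulVf // scale1r opprK addrC.
have [l lP] := choice coord.
have uniq w c : U (w - c *: v) -> l w = c.
  move=> Uc; apply/eqP/negPn/negP; rewrite -subr_eq0 => lc; apply: Uv.
  have := UZ (l w - c)^-1 _ (UB _ _ Uc (lP w)).
  by rewrite opprB [w - _ + _]addrC addrA subrK -scalerBl scalerA mulVf // scale1r.
have lL : linear (l : V -> k^o).
  move=> c x y; apply: (uniq _ (c * l x + l y)); rewrite scalerDl opprD addrACA -scalerA.
  by rewrite -scalerBr; apply: UL.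
pose l' : {linear V -> k^o} := HB.pack (l : V -> k^o)
  (GRing.isLinear.Build _ _ _ _ (l : V -> k^o) lL).
exists l'; by apply: uniq; rewrite scale1r subrr.
Qed.

Lemma in_span1 (V : lmodType k) (v w : V) :
  in_span (eq v) w -> exists c : k, w = c *: v.
Proof.
move/(_ (fun w => exists c : k, w = c *: v)).
apply=> [|c x y [a ->] [b ->]|s <-]; first by exists 0; rewrite scale0r.
- by exists (c * a + b); rewrite scalerDl scalerA.
- by exists 1; rewrite scale1r.
Qed.

(** A functional on the quotient by the line of v that does not vanish on the
class of w. *)
Lemma exists_functional_off_line (V : lmodType k) (v w : V) :
  (forall c : k, w <> c *: v) -> exists l : {linear V -> k^o}, l v = 0 /\ l w = 1.
Proof.
move=> wv; have [|l lw] := @exists_functional _ (lquot_pi (eq v) w).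
  apply/eqP; rewrite -(raddf0 (lquot_pi (eq v))) => /lquot_pi_eq; rewrite subr0.
  by case/in_span1 => c /wv.
exists (l \o lquot_pi (eq v)); split=> //=.
by rewrite lquot_piS // raddf0.
Qed.

End LinearFunctionals.

(** * Tensor products over the ground field *)

Section TensorOverField.
Variables (k : fieldType) (A C : algType k).
Variables (X : bimodType A k^o) (Y : bimodType k^o C).

Lemma tens_functionals (l : {linear X -> k^o}) (r : {linear Y -> k^o}) :
  balanced (fun x y => l x * r y : k^o).
Proof.
split=> [x x' y|x y y'|c x y|x c y].
- by rewrite linearD mulrDl.
- by rewrite linearD mulrDr.
- by rewrite linearZ /= scalerAl.
- have cE : c = c%:A :> k^o by rewrite /GRing.scale /= mulr1.
  by rewrite {1 2}cE ractZ lactZ !linearZ /= -scalerAl -scalerAr.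
Qed.

(** If x were not on the line of x', some l (x) r would kill x' (x) y' and not
x (x) y. *)
Lemma tens_inj_l (x x' : X) (y y' : Y) :
  y != 0 -> tens x y = tens x' y' -> exists c : k, x = c *: x'.
Proof.
move=> y0 xy; apply: contrapT => xx'.
have [|l [lx' lx]] := @exists_functional_off_line _ _ x' x.
  by move=> c xE; apply: xx'; exists c.
have [r ry] := exists_functional y0.
have := congr1 (tensor_lift (fun x y => l x * r y : k^o)) xy.
rewrite !(tensor_liftE (tens_functionals l r)) lx ry lx' mulr1 mul0r => /eqP.
by rewrite oner_eq0.
Qed.

Lemma tens_inj_r (x x' : X) (y y' : Y) :
  x != 0 -> tens x y = tens x' y' -> exists c : k, y = c *: y'.
Proof.
move=> x0 xy; apply: contrapT => yy'.
have [|r [ry' ry]] := @exists_functional_off_line _ _ y' y.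
  by move=> c yE; apply: yy'; exists c.
have [l lx] := exists_functional x0.
have := congr1 (tensor_lift (fun x y => l x * r y : k^o)) xy.
rewrite !(tensor_liftE (tens_functionals l r)) lx ry ry' mulr1 mulr0 => /eqP.
by rewrite oner_eq0.
Qed.

Lemma tens_neq0 (x : X) (y : Y) : x != 0 -> y != 0 -> tens x y != 0.
Proof.
move=> x0 y0; apply/eqP => xy.
have E : tens x y = tens 0 y by rewrite xy; have := tensZl 0 (0 : X) y; rewrite !scale0r.
by have [c] := tens_inj_l y0 E; rewrite scaler0; apply/eqP.
Qed.

End TensorOverField.

(** * Algebras equal to the ground field *)

Section GroundField.
Variables (k : fieldType).

Lemma exists_coordinate (V : lmodType k) (e : V) :
  e != 0 -> (forall x, exists c : k, x = c *: e) ->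
  exists l : {linear V -> k^o}, l e = 1 /\ forall x, x = l x *: e.
Proof.
move=> e0 eP; have [l le] := exists_functional e0.
exists l; split=> // x; have [c ->] := eP x.
by rewrite linearZ /= le; congr (_ *: e); rewrite /GRing.scale /= mulr1.
Qed.

(** The inverse of the structure map is the coordinate along 1. *)
Lemma is_ground_fieldP (A : algType k) :
  is_ground_field A <-> forall a : A, exists c : k, a = c%:A.
Proof.
split=> [[g gK Kg] a|AP]; first by exists (g a).
have [l [l1 lK]] := exists_coordinate (oner_neq0 A) AP.
exists l => [c|a]; last by rewrite -lK.
by rewrite linearZ /= l1 /GRing.scale /= mulr1.
Qed.

Lemma scalar_multiples_eq0 (A : algType k) (c : k) :
  ~ is_ground_field A -> (forall a : A, exists d : k, c *: a = d%:A) -> c = 0.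
Proof.
move=> nA cA; apply/eqP/negPn/negP => c0; apply: nA.
apply/is_ground_fieldP => a; have [d cad] := cA a.
by exists (c^-1 * d); rewrite -scalerA -cad scalerA mulVf // scale1r.
Qed.

End GroundField.

(** * Families of vectors and pure tensors *)

Section Ordinals.

Lemma lift_max_ord0 n : lift ord_max ord0 = ord0 :> 'I_n.+2.
Proof. exact: val_inj. Qed.

Lemma lift0_ord_max n : lift ord0 ord_max = ord_max :> 'I_n.+2.
Proof. exact: val_inj. Qed.

Lemma lift_max_lift0 n (i : 'I_n) :
  lift ord_max (lift ord0 i) = lift ord0 (lift ord_max i).
Proof. by apply: val_inj; rewrite /= /bump !add1n ltnS; case: (n <= i)%N. Qed.

End Ordinals.

Section PureTensors.
Variables (k : fieldType) (R : algType k) (V : bimodType R R).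

Definition consf n (v : V) (x : 'I_n -> V) (i : 'I_n.+1) : V :=
  if unlift ord0 i is Some j then x j else v.

Definition rconsf n (x : 'I_n -> V) (v : V) (i : 'I_n.+1) : V :=
  if unlift ord_max i is Some j then x j else v.

Lemma consf_ord0 n v (x : 'I_n -> V) : consf v x ord0 = v.
Proof. by rewrite /consf unlift_none. Qed.

Lemma consf_lift n v (x : 'I_n -> V) i : consf v x (lift ord0 i) = x i.
Proof. by rewrite /consf liftK. Qed.

Lemma rconsf_ord_max n (x : 'I_n -> V) v : rconsf x v ord_max = v.
Proof. by rewrite /rconsf unlift_none. Qed.

Lemma rconsf_lift n (x : 'I_n -> V) v i : rconsf x v (lift ord_max i) = x i.
Proof. by rewrite /rconsf liftK. Qed.

Lemma consf_eta n (x : 'I_n.+1 -> V) : x = consf (x ord0) (fun i => x (lift ord0 i)).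
Proof. by apply: funext => i; rewrite /consf; case: unliftP => [j|] ->. Qed.

Lemma rconsf_eta n (x : 'I_n.+1 -> V) :
  x = rconsf (fun i => x (lift ord_max i)) (x ord_max).
Proof. by apply: funext => i; rewrite /rconsf; case: unliftP => [j|] ->. Qed.

Lemma rconsf_consf n u (y : 'I_n -> V) v :
  rconsf (consf u y) v = consf u (rconsf y v).
Proof.
apply: funext => i; case: (unliftP ord0 i) => [j|] ->; last first.
  by rewrite consf_ord0 -lift_max_ord0 rconsf_lift consf_ord0.
rewrite consf_lift; case: (unliftP ord_max j) => [l|] ->.
  by rewrite -lift_max_lift0 !rconsf_lift consf_lift.
by rewrite lift0_ord_max !rconsf_ord_max.
Qed.

Lemma pure_consf n v (x : 'I_n -> V) : pure (consf v x) = tens v (pure x).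
Proof.
rewrite /= consf_ord0; congr (tens _ (pure _)).
by apply: funext => i; rewrite consf_lift.
Qed.

(** The right action is needed for n = 0: the 0-th power is R, where the only pure
tensor is 1. *)
Lemma tpow_ext n (W : lmodType k) (f g : tpow V n -> W) :
  linear f -> linear g ->
  (forall x r, f (ract (pure x) r) = g (ract (pure x) r)) -> f =1 g.
Proof.
elim: n f g => [|n IHn] f g fL gL fg.
  move=> t; have := fg (fun=> 0) t.
  by rewrite /ract /= mul1r.
apply: tensor_ext => // v; apply: IHn => [c t t'|c t t'|x r].
- by rewrite tensDr tensZr fL.
- by rewrite tensDr tensZr gL.
- by rewrite -ract_tens -pure_consf fg.
Qed.

Lemma bimodHom_pure_ext n (Y : bimodType R R) (f g : bimodHom (tpow V n) Y) :
  (forall x, f (pure x) = g (pure x)) -> f = g.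
Proof.
move=> fg; apply: bimodHomP; apply: tpow_ext => [||x r]; try exact: linearP.
by rewrite !bimodHom_ract fg.
Qed.

End PureTensors.

(** * Injectivity *)

Section Cancellation.
Variables (k : fieldType) (A B : algType k).
Local Notation M := (free_bimod B A).
Local Notation N := (free_bimod A B).
Local Notation V := (corners M N).
(* In the application [T] is the type of the vectors between u and v. *)
Variables (T : Type) (F : V -> T -> (A * B)%type) (G : T -> V -> (A * B)%type).
Hypothesis FG : forall u y v, ract u (G y v) = lact (F u y) v.

Let one_neq0B : (1 : lregular B) != 0 := oner_neq0 B.
Let one_neq0A : (1 : rregular A) != 0 := oner_neq0 A.

(* The M-corner keeps only the A-component of G and the B-component of F. *)
Let FGM u y v : ract u.1 (G y v).1 = lact (F u y).2 v.1.
Proof. exact: (congr1 fst (FG u y v)). Qed.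

Let corner_vec (b : B) (a : A) : V := (tens (b : lregular B) (a : rregular A) : M, 0).

Let FGtens b a y b' a' :
  tens (b : lregular B) ((a * (G y (corner_vec b' a')).1 : A) : rregular A) =
  tens (((F (corner_vec b a) y).2 * b' : B) : lregular B) (a' : rregular A).
Proof.
by have := FGM (corner_vec b a) y (corner_vec b' a'); rewrite ract_tens lact_tens.
Qed.

Let F_eq0 : (forall y, (G y (corner_vec 1 1)).1 = 0) -> forall u y, (F u y).2 = 0.
Proof.
move=> G0 u y; apply/eqP/negPn/negP => Fuy.
have := FGM u y (corner_vec 1 1); rewrite G0 ract0 /= lact_tens /= => /esym/eqP.
apply/negP; apply: tens_neq0 => //.
by rewrite /lact /= mulr1.
Qed.

Let G_eq0 : (forall y, (F (corner_vec 1 1) y).2 = 0) -> forall y v, (G y v).1 = 0.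
Proof.
move=> F0 y v; apply/eqP/negPn/negP => Gyv.
have := FGM (corner_vec 1 1) y v; rewrite F0 lact0l /= ract_tens /= => /eqP.
apply/negP; apply: tens_neq0 => //.
by rewrite /ract /= mul1r.
Qed.

(** Let g = (G y (corner_vec 1 1)).1, which does not depend on a. By [FGtens] with
b = b' = a' = 1, every a * g is a scalar, so g = 0 if A is not k. In the same way
f = (F (corner_vec 1 1) y).2 vanishes if B is not k, on varying b'. The remaining
values follow by [F_eq0] and [G_eq0]. *)
Lemma corners_cancel :
  ~ (is_ground_field A /\ is_ground_field B) ->
  (forall u y, (F u y).2 = 0) /\ (forall y v, (G y v).1 = 0).
Proof.
move=> nAB; have [nA|nB] : ~ is_ground_field A \/ ~ is_ground_field B.
- exact/not_andP.
- suff /F_eq0 F0 : forall y, (G y (corner_vec 1 1)).1 = 0 by split=> //; apply: G_eq0.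
  move=> y; set g := (G _ _).1.
  have ag a : exists d : k, a * g = d%:A by apply: (tens_inj_r one_neq0B (FGtens 1 a y 1 1)).
  have [c gc] := ag 1; rewrite mul1r in gc.
  rewrite gc (scalar_multiples_eq0 nA (c := c)) ?scale0r // => a.
  by have := ag a; rewrite gc mulZr.
- suff /G_eq0 G0 : forall y, (F (corner_vec 1 1) y).2 = 0 by split=> //; apply: F_eq0.
  move=> y; set f := (F _ _).2.
  have fb b : exists d : k, f * b = d%:A.
    by apply: (tens_inj_l one_neq0A (esym (FGtens 1 1 y b 1))).
  have [c fc] := fb 1; rewrite mulr1 in fc.
  rewrite fc (scalar_multiples_eq0 nB (c := c)) ?scale0r // => b.
  by have := fb b; rewrite fc mulZl.
Qed.

End Cancellation.

Lemma ractB (k : fieldType) (C D : algType k) (X : bimodType C D) (x : X) (a b : D) :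
  ract x (a - b) = ract x a - ract x b.
Proof. by rewrite ractDr -scaleN1r ractS scaleN1r. Qed.

Lemma lactB (k : fieldType) (C D : algType k) (X : bimodType C D) (x : X) (a b : C) :
  lact (a - b) x = lact a x - lact b x.
Proof. by rewrite lactDl -scaleN1r lactS scaleN1r. Qed.

Lemma subr_exchange (U : zmodType) (a b c d : U) : a - b = c - d -> a - c = b - d.
Proof. by move=> abcd; rewrite -(subrK b a) abcd addrAC [c - d]addrC addrK addrC. Qed.

(** The identities to which [corners_cancel] applies are the equality of the two
coboundaries on the pure tensor of u, y, v. *)
Lemma delta_injective (k : fieldType) (A B : algType k) n :
  ~ (is_ground_field A /\ is_ground_field B) ->
  injective (@delta k _ (corners (free_bimod B A) (free_bimod A B)) n.+1).
Proof.
move=> nAB f g fg; apply: bimodHom_pure_ext => x.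
set V := corners _ _ in f g fg x *.
pose D (z : 'I_n.+1 -> V) : (A * B)%type := f (pure z) - g (pure z).
have [F0 G0] : (forall u y, (D (consf u y)).2 = 0) /\ (forall y v, (D (rconsf y v)).1 = 0).
  apply: corners_cancel nAB => u y v.
  pose z := rconsf (consf u y) v.
  have z0 : z ord0 = u by rewrite /z rconsf_consf consf_ord0.
  have zm : z ord_max = v by exact: rconsf_ord_max.
  have zi : (fun i => z (lift ord_max i)) = consf u y.
    by apply: funext => i; rewrite /z rconsf_lift.
  have zt : (fun i => z (lift ord0 i)) = rconsf y v.
    by apply: funext => i; rewrite /z rconsf_consf consf_lift.
  have : delta f (pure z) = delta g (pure z) by rewrite fg.
  rewrite !deltaE z0 zm zi zt /D ractB lactB.
  exact: subr_exchange.
apply/eqP; rewrite -subr_eq0; apply/eqP.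
rewrite -[LHS]/(D x) [D x]surjective_pairing; congr (_, _).
  by rewrite [x]rconsf_eta.
by rewrite [x]consf_eta.
Qed.

(** * Iterating an associative product *)

Lemma eq_subr0 (U : zmodType) (a b : U) : a = b -> a - b = 0.
Proof. by move=> ->; rewrite subrr. Qed.

Section AssociativeProduct.
Variables (k : fieldType) (R : algType k) (V : bimodType R R).
Variable mu : bimodHom (tensor V V) (regular R).
Hypothesis mu_assoc : forall u v w,
  lact (mu (tens u v) : R) w = ract u (mu (tens v w) : R).

Fact id_linear : linear (id : regular R -> regular R). Proof. by []. Qed.
Definition id_hom : bimodHom (tpow V 0) (regular R) :=
  @BimodHom _ _ _ (regular R) (regular R) id id_linear
    (fun _ _ => erefl) (fun _ _ => erefl).

Section Step.
Variables (n : nat) (phi : bimodHom (tpow V n) (regular R)).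

Let step_fun (v : V) (t : tpow V n.+1) : regular R := mu (tens v (delta_left phi t)).

Fact step_balanced : balanced step_fun.
Proof.
rewrite /step_fun; split=> [x x' y|x y y'|c x y|x r y].
- by rewrite tensDl raddfD.
- by rewrite !raddfD /= tensDr raddfD.
- by rewrite tensZl linearZ.
- by rewrite bimodHom_lact tensB.
Qed.
Fact step_lact a v t : step_fun (lact a v) t = lact a (step_fun v t).
Proof. by rewrite /step_fun -lact_tens bimodHom_lact. Qed.
Fact step_ract v t a : step_fun v (ract t a) = ract (step_fun v t) a.
Proof. by rewrite /step_fun bimodHom_ract -ract_tens bimodHom_ract. Qed.

(** The form taking v, w, t to the scalar mu(v, w phi(t)): a product of two vectors
is put before phi. *)
Definition product_step : bimodHom (tpow V n.+2) (regular R) :=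
  tensor_hom step_balanced step_lact step_ract.

Lemma product_stepE (x : 'I_n.+2 -> V) :
  product_step (pure x) =
  mu (tens (x ord0) (ract (x (lift ord0 ord0))
     (phi (pure (fun i => x (lift ord0 (lift ord0 i))))))).
Proof.
by apply: etrans (tensor_homE _ _ _ _ _) _; rewrite /step_fun; congr (mu (tens _ _));
  apply: delta_leftE.
Qed.

(** Moving brackets in x_0 mu(x_1, x_2 phi(t)) with the associativity of mu, and
then using delta phi = 0 on the remaining vectors. *)
Lemma delta_product_step :
  (forall x, delta phi (pure x) = 0) -> forall x, delta product_step (pure x) = 0.
Proof.
move=> dphi x; apply: etrans (deltaE product_step x) _.
apply: (@eq_subr0 V).
apply: etrans (congr1 (ract _) (product_stepE _)) _.
apply: etrans (congr1 (fun r : R => lact r _) (esym (product_stepE _))).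
pose y i := x (lift ord0 (lift ord0 i)).
have /eqP := dphi y; rewrite deltaE subr_eq0 => /eqP dy.
have -> : (fun i => x (lift ord_max (lift ord0 (lift ord0 i)))) =
          (fun i => y (lift ord_max i)).
  by apply: funext => i; rewrite /y !lift_max_lift0.
rewrite !lift_max_lift0 !lift_max_ord0.
have -> : x ord_max = y ord_max by rewrite /y !lift0_ord_max.
rewrite mu_assoc; congr (ract _ (mu _)).
by rewrite tensB -dy.
Qed.
End Step.

(** The product of 2m vectors in pairs. Its value on the constant family e is
recorded to show that it is not zero. *)
Lemma exists_iterated_product m (e : V) : mu (tens e e) = 1 :> R ->
  exists phi : bimodHom (tpow V m.*2) (regular R),
    (forall x, delta phi (pure x) = 0) /\ phi (pure (fun=> e)) = 1 :> R.
Proof.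
move=> mu1; elim: m => [|m [phi [dphi phi1]]].
  exists id_hom; split=> // x; apply: etrans (deltaE id_hom x) _.
  have -> : ord_max = ord0 :> 'I_1 by apply: val_inj.
  by apply: eq_subr0; rewrite /= ract1 lact1.
exists (product_step phi); split; first exact: delta_product_step.
by apply: etrans (product_stepE _ _) _; rewrite phi1 ract1.
Qed.

End AssociativeProduct.

(** * The exceptional case *)

Section ZeroHom.
Variables (k : fieldType) (C D : algType k) (X Y : bimodType C D).

Let zero_fun (_ : X) : Y := 0.
Fact zero_linear : linear zero_fun.
Proof. by move=> c u v; rewrite /zero_fun scaler0 addr0. Qed.
Fact zero_lact a x : zero_fun (lact a x) = lact a (zero_fun x).
Proof. by rewrite /zero_fun lact0. Qed.
Fact zero_ract x b : zero_fun (ract x b) = ract (zero_fun x) b.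
Proof. by rewrite /zero_fun ract0l. Qed.
Definition zero_hom : bimodHom X Y := BimodHom zero_linear zero_lact zero_ract.
End ZeroHom.

(** Over the ground field, the corner is the line spanned by 1 (x) 1. *)
Lemma free_bimod_coordinate (k : fieldType) (A B : algType k) :
  is_ground_field A -> is_ground_field B ->
  let e : free_bimod A B := tens (1 : lregular A) (1 : rregular B) in
  exists l : {linear free_bimod A B -> k^o}, l e = 1 /\ forall x, x = (l x : k) *: e.
Proof.
move=> /is_ground_fieldP Ak /is_ground_fieldP Bk e.
have [l le] : exists l : {linear free_bimod A B -> k^o}, l e = 1.
  by apply: exists_functional; apply: tens_neq0; apply: oner_neq0.
exists l; split=> // x; move: x; apply: tensor_ext => [//|c x y|a b].
  by rewrite linearP scalerDl scalerA.
have [[c ->] [d ->]] := (Ak a, Bk b).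
have -> : tens (c%:A : lregular A) (d%:A : rregular B) = (c * d) *: e.
  by rewrite -scalerA -tensZr -tensZl.
rewrite linearZ /= le; congr (_ *: _).
by rewrite /GRing.scale /= mulr1.
Qed.

Section RankOneProduct.
Variables (k : fieldType) (A B : algType k).
Variables (M : bimodType B A) (N : bimodType A B).
Hypotheses (Ak : forall a : A, exists c : k, a = c%:A).
Hypotheses (Bk : forall b : B, exists c : k, b = c%:A).
Variables (p : {linear M -> k^o}) (q : {linear N -> k^o}) (e : M) (f : N).
Hypothesis pE : forall x, x = (p x : k) *: e.
Hypothesis qE : forall y, y = (q y : k) *: f.
Local Notation V := (corners M N).
Local Notation R := (A * B)%type.

(* The product of the off-diagonal matrices with entries p u.1, q u.2 and p v.1, q v.2. *)
Let mul_fun (u v : V) : regular R :=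
  (((q u.2 : k) * p v.1)%:A, ((p u.1 : k) * q v.2)%:A).

(* As A and B consist of scalars, k-linearity gives the behaviour under both actions. *)
Let scalars (P : R -> Prop) : (forall c d : k, P (c%:A, d%:A)) -> forall r, P r.
Proof. by move=> Pcd [a b]; have [[c ->] [d ->]] := (Ak a, Bk b). Qed.

Fact mul_balanced : balanced mul_fun.
Proof.
rewrite /mul_fun; split=> [x x' y|x y y'|c x y|x r y] /=.
- by rewrite !raddfD /= !mulrDl !scalerDl.
- by rewrite !raddfD /= !mulrDr !scalerDl.
- transitivity ((c * (q x.2 * p y.1))%:A : A, (c * (p x.1 * q y.2))%:A : B).
    rewrite !linearZ; congr (_ *: _, _ *: _); exact: esym (mulrA _ _ _).
  by congr (_, _); rewrite -scalerA.
- elim/scalars: r => c d /=.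
  have mulCA (a a' b : k) : a * a' * b = a' * (a * b) by rewrite mulrCA mulrA.
  by rewrite !ractZ !lactZ !linearZ; congr (_ *: _, _ *: _); apply: mulCA.
Qed.
Fact mul_lact r u v : mul_fun (lact r u) v = lact r (mul_fun u v).
Proof.
elim/scalars: r => c d; rewrite /mul_fun /= !lactZ !linearZ.
rewrite [RHS](_ : _ = (c%:A * (q u.2 * p v.1)%:A, d%:A * (p u.1 * q v.2)%:A)) //.
by rewrite !mulZl !scalerA; congr (_ *: _, _ *: _); apply: esym (mulrA _ _ _).
Qed.
Fact mul_ract u v r : mul_fun u (ract v r) = ract (mul_fun u v) r.
Proof.
elim/scalars: r => c d; rewrite /mul_fun /= !ractZ !linearZ.
rewrite [RHS](_ : _ = ((q u.2 * p v.1)%:A * c%:A, (p u.1 * q v.2)%:A * d%:A)) //.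
by rewrite !mulZr !scalerA; congr (_ *: _, _ *: _); apply: mulrCA.
Qed.

Definition corner_product : bimodHom (tensor V V) (regular R) :=
  tensor_hom mul_balanced mul_lact mul_ract.

Lemma corner_productE u v : corner_product (tens u v) = mul_fun u v.
Proof. exact: tensor_homE. Qed.

(** In the M-corner both sides are p u.1 * q v.2 * p w.1 times e, since u.1 and w.1
are multiples of e; the N-corner is symmetric. *)
Lemma corner_product_assoc (u v w : V) :
  lact (corner_product (tens u v) : R) w = ract u (corner_product (tens v w) : R).
Proof.
apply: etrans (congr1 (fun r : R => lact r w) (corner_productE u v)) _.
apply: etrans _ (congr1 (fun r : R => ract u r) (esym (corner_productE v w))).
congr (_, _); rewrite /= lactZ ractZ.
  by rewrite {1}[w.1]pE {2}[u.1]pE !scalerA -mulrA mulrC.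
by rewrite {1}[w.2]qE {2}[u.2]qE !scalerA -mulrA mulrC.
Qed.

End RankOneProduct.

(** The iterated product of [corner_product] is killed by delta, and is 1 on the
family constantly equal to the pair of generators. *)
Lemma delta_not_injective (k : fieldType) (A B : algType k) m :
  is_ground_field A -> is_ground_field B ->
  ~ injective (@delta k _ (corners (free_bimod B A) (free_bimod A B)) m.*2).
Proof.
move=> Ak Bk inj.
have [p [p1 pE]] := free_bimod_coordinate Bk Ak.
have [q [q1 qE]] := free_bimod_coordinate Ak Bk.
have AP := (is_ground_fieldP A).1 Ak; have BP := (is_ground_fieldP B).1 Bk.
set V := corners _ _ in inj.
pose e : V := (tens (1 : lregular B) (1 : rregular A) : free_bimod B A,
               tens (1 : lregular A) (1 : rregular B) : free_bimod A B).
have [|phi [dphi phi1]] :=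
  exists_iterated_product (corner_product_assoc AP BP pE qE) m (e := e).
  by rewrite corner_productE /= p1 q1 mulr1 scale1r scale1r.
have phi0 : phi = zero_hom _ _.
  by apply: inj; apply: bimodHom_pure_ext => x; rewrite dphi deltaE ract0 lact0l subrr.
by have /eqP := phi1; rewrite phi0 eq_sym oner_eq0.
Qed.

Theorem proposition7p6 (k : fieldType) (A B : algType k)
    (L : squareAlgebra (free_bimod B A) (free_bimod A B)) (m : nat) :
  (0 < m)%N ->
  (injective (nabla L m) <-> ~ (is_ground_field A /\ is_ground_field B)).
Proof.
move=> m_gt0.
suff: injective (@delta k _ (corners (free_bimod B A) (free_bimod A B)) (2 * m)) <->
    ~ (is_ground_field A /\ is_ground_field B) by [].
split=> [|nAB].
  by rewrite mul2n => inj [Ak Bk]; exact: (delta_not_injective Ak Bk inj).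
have E : (2 * m = (2 * m).-1.+1)%N by rewrite prednK ?muln_gt0.
rewrite E; exact: (@delta_injective k A B _ nAB).
Qed.
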